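(* Consider the discrete-time system of $n$ heterogeneous single-server queues described in the context, operated under the $k$-SLQ-$d$ policy with fixed integers $k\ge 1$ and $d\in\{1,\dots,n-1\}$. Then the Markov chain $\{\mathbf{X}(t)\}_{t\ge 0}$ is positive recurrent if and only if $$ n\lambda < \min_{I\subseteq [n]\,:\,|I|\ge d+1}\left\{\frac{n-d}{|I|-d}\sum_{l\in I}\mu_l\right\}. $$
   Context: Model: time is discrete, $t=0,1,2,\dots$. There are $n$ FIFO single-server queues of infinite capacity; $Q_i(t)$ is the length of queue $i$ at the beginning of slot $t$, $\mathbf{Q}(t)=(Q_1(t),\dots,Q_n(t))$. Jobs arrive as an i.i.d. process $\{A(t)\}_{t\ge0}$ of nonnegative integers with $\mathbb E[A(1)]=n\lambda$, $\mathrm{Var}(A(1))=n\sigma_\lambda^2$ and $A(1)\le nA_{\max}$ a.s. All $A(t)$ jobs arriving in slot $t$ are sent to a single queue chosen by the policy; write $\mathbf Y(t)\in\{0,1\}^n$ for the indicator of that queue. Server $i$ offers potential service $S_i(t)$ in slot $t$; the $\mathbf S(t)$ are i.i.d. over time, independent of arrivals and of queue lengths, with $\mathbb E[S_i(1)]=\mu_i$, $\mathrm{Var}(S_i(1))=\sigma_{\mu_i}^2$, $S_i(1)\le S_{\max}$ a.s., and $0<\mu_{\min}\le\mu_i\le\mu_{\max}$. Dynamics: $\mathbf Q(t+1)=[\mathbf Q(t)+A(t)\mathbf Y(t)-\mathbf S(t)]^+$ (componentwise positive part). $[n]=\{1,\dots,n\}$. The $k$-SLQ-$d$ policy (Skip-the-$d$-Longest-Queues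 with $k$ rounds): at every slot $t$ that is a multiple of $k(n-d)$, the dispatcher observes $\mathbf Q(t)$ and computes the set $I_d(t)$ of indices of the $d$ longest queues (ties broken uniformly at random). During the $k(n-d)$ slots starting at $t$ (including $t$), arriving jobs are dispatched in Round-Robin fashion over the $n-d$ indices in $[n]\setminus I_d(t)$, for $k$ full Round-Robin rounds. The system is modeled by the Markov chain $\mathbf X(t)=(\mathbf Q(t),I_d(t),I_R(t),N_R(t))$, where $I_d(t)$ is the set of the $d$ longest queues determined at the last observation time $t-[t \bmod k(n-d)]$, $I_R(t)\in[n]$ is the queue receiving arrivals in slot $t$, and $N_R(t)\in\{0,\dots,k-1\}$ is the number of Round-Robin rounds completed since the last observation time.
   Formalization: Since the chain need not be irreducible, ''positive recurrent'' is taken to mean that some finite set of states is reached in finite expected time from every initial state, which agrees with the usual notion for irreducible chains. *)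

(* Defs.v *)
From HB Require Import structures.
From mathcomp Require Import all_boot all_order all_algebra.
From mathcomp Require Import reals.
Set Implicit Arguments. Unset Strict Implicit. Unset Printing Implicit Defensive.
Import Order.TTheory GRing.Theory Num.Theory.
Local Open Scope ring_scope.

Definition qvec (n : nat) := {ffun 'I_n -> nat}.

(* A realisation of the potential-service vector S(t): S_i(t) in {0..Smax}. *)
Definition svec (n Smax : nat) := {ffun 'I_n -> 'I_Smax.+1}.

(* State X(t) = (Q(t), I_d(t), I_R(t), N_R(t)); N_R is a nat with N_R < k
   (enforced by [valid_state]). *)
Definition state (n : nat) := (qvec n * {set 'I_n} * 'I_n * nat)%type.

Definition valid_state (n d k : nat) (x : state n) : Prop :=
  let: (Q, Id, ir, nr) := x in [/\ #|Id| = d, ir \notin Id & (nr < k)%N].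

(* Mean number of arrivals per slot, E[A(1)] = n * lambda. *)
Definition arrival_mean (R : realType) (n Amax : nat)
  (pA : {ffun 'I_(n * Amax).+1 -> R}) : R :=
  \sum_(a : 'I_(n * Amax).+1) pA a * (a : nat)%:R.

Definition mu (R : realType) (n Smax : nat) (pS : {ffun svec n Smax -> R})
  (i : 'I_n) : R :=
  \sum_(s : svec n Smax) pS s * (s i : nat)%:R.

Definition rr_seq (n : nat) (Id : {set 'I_n}) : seq 'I_n :=
  [seq i <- enum 'I_n | i \notin Id].

Definition rr_next (n : nat) (Id : {set 'I_n}) (i : 'I_n) : option 'I_n :=
  let s := rr_seq Id in
  if ((index i s).+1 < size s)%N then Some (nth i s (index i s).+1) else None.

(* First index of a Round-Robin round (default only used if [n]\I_d is empty). *)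
Definition rr_first (n : nat) (Id : {set 'I_n}) (dflt : 'I_n) : 'I_n :=
  nth dflt (rr_seq Id) 0.

(* Q(t+1) = [Q(t) + A(t) Y(t) - S(t)]^+  (nat subtraction is truncated). *)
Definition qnext (n Smax : nat) (Q : qvec n) (ir : 'I_n) (a : nat)
  (s : svec n Smax) : qvec n :=
  [ffun j => (Q j + (if j == ir then a else 0%N)) - s j]%N.

(* All admissible choices of "the d longest queues" for Q; the policy picks
   one of them uniformly at random (uniform tie-breaking). *)
Definition longest_sets (n d : nat) (Q : qvec n) : {set {set 'I_n}} :=
  [set I : {set 'I_n} | (#|I| == d) &&
     [forall i in I, forall j in ~: I, (Q j <= Q i)%N]].

(* Deterministic part of one transition, given A(t)=a, S(t)=s and the set
   Inew of d longest queues to be used if slot t+1 is an observation time. *)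
Definition step (n k Smax : nat) (x : state n) (a : nat) (s : svec n Smax)
  (Inew : {set 'I_n}) : state n :=
  let: (Q, Id, ir, nr) := x in
  let Q' := qnext Q ir a s in
  match rr_next Id ir with
  | Some j => (Q', Id, j, nr)
  | None =>
      if (nr.+1 < k)%N then (Q', Id, rr_first Id ir, nr.+1)
      else (Q', Inew, rr_first Inew ir, 0%N)
  end.

(* Transition kernel applied to a function: E[ f(X(t+1)) | X(t) = x ].
   A(t) ~ pA, S(t) ~ pS, independent, and the tie-break is uniform over
   longest_sets Q(t+1) (independent of everything else). *)
Definition Ekernel (R : realType) (n d k Amax Smax : nat)
  (pA : {ffun 'I_(n * Amax).+1 -> R}) (pS : {ffun svec n Smax -> R})
  (f : state n -> R) (x : state n) : R :=
  \sum_(a : 'I_(n * Amax).+1) \sum_(s : svec n Smax)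
    pA a * pS s *
    (let Q' := qnext x.1.1.1 x.1.2 a s in
     \sum_(I in longest_sets d Q') f (step k x a s I) / #|longest_sets d Q'|%:R).

(* avoid B t x = P_x( X(1), ..., X(t) all outside B ) = P_x(sigma_B > t),
   where sigma_B = min { t >= 1 : X(t) \in B }. *)
Fixpoint avoid (R : realType) (n d k Amax Smax : nat)
  (pA : {ffun 'I_(n * Amax).+1 -> R}) (pS : {ffun svec n Smax -> R})
  (B : seq (state n)) (t : nat) (x : state n) : R :=
  match t with
  | 0 => 1
  | t'.+1 => Ekernel d k pA pS
               (fun y => if y \in B then 0 else avoid d k pA pS B t' y) x
  end.

(* Positive recurrence of {X(t)}: there is a finite set B of states such that
   from every (valid) initial state the expected (return/hitting) time
   E_x[sigma_B] = sum_{t>=0} P_x(sigma_B > t) is finite. *)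
Definition positive_recurrent (R : realType) (n d k Amax Smax : nat)
  (pA : {ffun 'I_(n * Amax).+1 -> R}) (pS : {ffun svec n Smax -> R}) : Prop :=
  exists B : seq (state n),
    forall x : state n, valid_state d k x ->
      exists M : R, forall T : nat, \sum_(t < T) avoid d k pA pS B t x <= M.

(* Main.v *)
(* Let c_i be the number of slots left in the current observation period in
   which queue i receives the arrivals, r = sum_i c_i, L = E[A(1)], and
   W_i = Q_i + L c_i - r mu_i. Within a period W_i is a martingale up to the
   truncation of the queues at 0, so only the observation times matter.

   Necessity: if a set I violates the condition, then sum_(i in I) W_i is a
   submartingale with bounded increments, because each period feeds at least
   |I| - d queues of I. Started above its maximum on a finite set B, it forces
   P(sigma_B > t) >= H / (H + C t), which is not summable. This also covers
   equality in the condition.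

   Sufficiency: V = sum_i W_i^2 + delta r sum_i Q_i is a Lyapunov function.
   The observation step changes sum_i W_i^2 by at most - c sum_i Q_i + O(1), and
   the second term spreads this decrease evenly over the slots of the
   period. *)
Require Import Defs.
From HB Require Import structures.
From mathcomp Require Import all_boot all_order all_algebra.
From mathcomp Require Import reals.
From mathcomp Require Import zify ring lra.
Set Implicit Arguments. Unset Strict Implicit. Unset Printing Implicit Defensive.
Import Order.TTheory GRing.Theory Num.Theory.
Local Open Scope ring_scope.

(** * Round-Robin bookkeeping and the sets of longest queues *)

Section RoundRobin.
Variables n d k Smax : nat.
Hypothesis lt_dn : (d < n)%N.
Implicit Types (x : state n) (Q : qvec n) (Id I : {set 'I_n}) (s : svec n Smax).

Lemma mem_rr_seq Id i : (i \in rr_seq Id) = (i \notin Id).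
Proof. by rewrite mem_filter mem_enum andbT. Qed.

Lemma rr_seq_uniq Id : uniq (rr_seq Id).
Proof. exact/filter_uniq/enum_uniq. Qed.

Lemma size_rr_seq Id : #|Id| = d -> size (rr_seq Id) = (n - d)%N.
Proof.
move=> cId; rewrite -(card_uniqP (rr_seq_uniq Id)).
rewrite (@eq_card _ _ (~: Id)); last by move=> i; rewrite mem_rr_seq inE.
by rewrite cardsCs setCK cId card_ord.
Qed.

(* The number of slots left in the current observation period (the present
   slot included) in which queue [i] receives the arrivals. *)
Definition slots x (i : 'I_n) : nat :=
  let: (Q, Id, ir, nr) := x in
  if i \in Id then 0
  else (k.-1 - nr + (index ir (rr_seq Id) <= index i (rr_seq Id)))%N.

Lemma slots_le x i : valid_state d k x -> (slots x i <= k)%N.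
Proof.
case: x => [[[Q Id] ir] nr] [_ _ lt_nr] /=.
by case: ifP => // _; case: leqP => /=; lia.
Qed.

Lemma rr_first_notin I i0 : #|I| = d -> rr_first I i0 \notin I.
Proof.
by move=> cI; rewrite -mem_rr_seq mem_nth // size_rr_seq // subn_gt0.
Qed.

Lemma valid_step x a s I :
  valid_state d k x -> #|I| = d -> valid_state d k (step k x a s I).
Proof.
case: x => [[[Q Id] ir] nr] [cId irNId lt_nr] cI.
rewrite /step /rr_next; case: ifP => [lt_ir|_].
  by split; rewrite // -mem_rr_seq mem_nth.
by case: ifP => lt_nr1; split=> //; rewrite ?rr_first_notin //; lia.
Qed.

Lemma step_queue x a s I : (step k x a s I).1.1.1 = qnext x.1.1.1 x.1.2 a s.
Proof.
case: x => [[[Q Id] ir] nr] /=; rewrite /step.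
by case: (rr_next Id ir) => //=; case: ifP.
Qed.

Lemma slots_new_period Q I i0 i : (0 < k)%N -> #|I| = d ->
  slots (Q, I, rr_first I i0, 0%N) i = if i \in I then 0%N else k.
Proof.
move=> k0 cI /=; case: ifP => // iI.
by rewrite /rr_first index_uniq ?rr_seq_uniq ?size_rr_seq ?subn_gt0 //; lia.
Qed.

(** Either the period goes on and the receiving queue uses up one of its slots, or the present slot
    is the last of its period and all counts are reset. The three branches of [step] give next
    position, next round and new period. *)
Lemma slots_step x : (0 < k)%N -> valid_state d k x ->
  (forall a s I i, slots x i = slots (step k x a s I) i + (i == x.1.2))%N \/
  (forall i, slots x i = (i == x.1.2)) /\
  (forall a s I i, #|I| = d ->
     slots (step k x a s I) i = if i \in I then 0%N else k).
Proof.
move=> k0; case: x => [[[Q Id] ir] nr] [cId irNId lt_nr] /=.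
have irs : ir \in rr_seq Id by rewrite mem_rr_seq.
have lt_ir : (index ir (rr_seq Id) < size (rr_seq Id))%N by rewrite index_mem.
have idx_eq i : i \notin Id ->
    (index i (rr_seq Id) == index ir (rr_seq Id)) = (i == ir).
  move=> iNId; apply/eqP/eqP => [|-> //] eq_idx.
  by rewrite -(nth_index ir irs) -eq_idx nth_index // mem_rr_seq.
have irId i : i \in Id -> (i == ir) = false.
  by move=> iId; apply: contraNF irNId => /eqP <-.
rewrite /rr_next; case: ifP => [lt_ir1|last_ir].
  left=> a s I i; rewrite /=; case: ifP => [/irId-> //|/negbT iNId].
  rewrite index_uniq ?rr_seq_uniq // -addnA; congr (_ + _)%N.
  by rewrite -idx_eq //; case: ltngtP.
(* Here [ir] is the last queue of its round, so no other queue outside [Id] has an index at or above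
   its own. *)
have le_idx i : i \notin Id ->
    (index ir (rr_seq Id) <= index i (rr_seq Id))%N = (i == ir).
  move=> iNId; have := iNId; rewrite -mem_rr_seq -index_mem -idx_eq // => lt_i.
  move: lt_ir last_ir lt_i; move: (index ir _) (index i _) (size _) => p q m.
  by lia.
case lt_nr1: (nr.+1 < k)%N.
  left=> a s I i; rewrite /=; case: ifP => [/irId-> //|/negbT iNId].
  rewrite le_idx // /rr_first index_uniq ?rr_seq_uniq ?(leq_ltn_trans _ lt_ir) //.
  by rewrite leq0n; case: (i == ir) => /=; lia.
right; split=> [i|a s I i cI]; last exact: slots_new_period.
case: ifP => [/irId-> //|/negbT iNId]; rewrite le_idx //.
by case: (i == ir) => /=; lia.
Qed.

(** Induction on the number of chosen queues, adding each time a longest queue among the others.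
    This makes the uniform tie-break in the kernel a genuine average. *)
Lemma longest_sets_neq0 Q : (0 < #|longest_sets d Q|)%N.
Proof.
suff [I] : exists I, I \in longest_sets d Q by move=> QI; apply/card_gt0P; exists I.
elim: d (ltnW lt_dn) => [|e IHe] lt_en.
  by exists set0; rewrite inE cards0 eqxx; apply/forall_inP => i; rewrite inE.
have [I] := IHe (ltnW lt_en); rewrite inE => /andP[/eqP cI /forall_inP maxI].
have /card_gt0P[i0 i0I] : (0 < #|~: I|)%N.
  by rewrite cardsCs setCK cI card_ord subn_gt0.
have [j jI maxj] := arg_maxnP (fun i => Q i) i0I.
have jNI : j \notin I by rewrite -in_setC.
exists (j |: I); rewrite inE cardsU1 cI jNI eqxx /=.
apply/forall_inP => i; rewrite !inE => iI; apply/forall_inP => l.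
rewrite !inE negb_or => /andP[_ lI].
case/orP: iI => [/eqP-> | /maxI/forall_inP]; last by apply; rewrite inE.
by apply: maxj; apply/setCP/negP.
Qed.

Lemma longest_sets_card Q I : I \in longest_sets d Q -> #|I| = d.
Proof. by rewrite inE => /andP[/eqP]. Qed.

Lemma longest_sets_ge Q I i j :
  I \in longest_sets d Q -> i \in I -> j \notin I -> (Q j <= Q i)%N.
Proof.
rewrite inE => /andP[_ /forall_inP maxI] /maxI/forall_inP h jI.
by apply: h; rewrite inE.
Qed.

End RoundRobin.

(** * One-slot expectations, Foster's criterion and a lower bound on avoidance probabilities *)

Section Expectation.
Variables (R : realType) (n d k Amax Smax : nat).
Variables (pA : {ffun 'I_(n * Amax).+1 -> R}) (pS : {ffun svec n Smax -> R}).
Hypothesis lt_dn : (d < n)%N.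
Hypotheses (pA_ge0 : forall a, 0 <= pA a) (pA_sum : \sum_a pA a = 1).
Hypotheses (pS_ge0 : forall s, 0 <= pS s) (pS_sum : \sum_s pS s = 1).

Implicit Types (f g : state n -> R) (x : state n).
Implicit Types h : 'I_(n * Amax).+1 -> svec n Smax -> R.

Local Notation Ek := (Ekernel d k pA pS).
Local Notation valid := (valid_state d k).
Local Notation Lam := (arrival_mean pA).

(** Tie-breaking is left out: the random fluctuation of a slot comes from arrivals and services
    alone. *)
Definition Eslot (h : 'I_(n * Amax).+1 -> svec n Smax -> R) : R :=
  \sum_a \sum_s pA a * pS s * h a s.

Lemma Eslot_ext h1 h2 : (forall a s, h1 a s = h2 a s) -> Eslot h1 = Eslot h2.
Proof. by move=> e; apply: eq_bigr => a _; apply: eq_bigr => s _; rewrite e. Qed.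

Lemma EslotD h1 h2 :
  Eslot (fun a s => h1 a s + h2 a s) = Eslot h1 + Eslot h2.
Proof.
rewrite -big_split; apply: eq_bigr => a _; rewrite -big_split.
by apply: eq_bigr => s _; rewrite mulrDr.
Qed.

Lemma EslotZ c h : Eslot (fun a s => c * h a s) = c * Eslot h.
Proof.
rewrite mulr_sumr; apply: eq_bigr => a _; rewrite mulr_sumr.
by apply: eq_bigr => s _; rewrite mulrCA.
Qed.

Lemma Eslot_sum (I : Type) (r : seq I) (P : pred I)
    (F : I -> 'I_(n * Amax).+1 -> svec n Smax -> R) :
  Eslot (fun a s => \sum_(i <- r | P i) F i a s) =
  \sum_(i <- r | P i) Eslot (F i).
Proof.
rewrite exchange_big; apply: eq_bigr => a _; rewrite exchange_big.
by apply: eq_bigr => s _; rewrite mulr_sumr.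
Qed.

Lemma Eslot_cst c : Eslot (fun _ _ => c) = c.
Proof.
transitivity (\sum_a pA a * c); last by rewrite -mulr_suml pA_sum mul1r.
apply: eq_bigr => a _; rewrite -mulr_suml -mulr_sumr pS_sum mulr1.
by [].
Qed.

Lemma Eslot_arrival : Eslot (fun a _ => (a : nat)%:R) = Lam.
Proof.
by apply: eq_bigr => a _; rewrite -mulr_suml -mulr_sumr pS_sum mulr1.
Qed.

Lemma Eslot_service i : Eslot (fun _ s => (s i : nat)%:R) = mu pS i.
Proof.
rewrite /Eslot exchange_big; apply: eq_bigr => s _.
by rewrite -mulr_suml -mulr_suml pA_sum mul1r.
Qed.

Lemma Eslot_le h1 h2 : (forall a s, h1 a s <= h2 a s) -> Eslot h1 <= Eslot h2.
Proof.
move=> le_h; apply: ler_sum => a _; apply: ler_sum => s _.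
by rewrite ler_wpM2l // mulr_ge0.
Qed.

(* Uniform tie-breaking averages over the admissible sets, so bounds that are
   uniform in the chosen set pass to the kernel. *)
Lemma Ekernel_le_Eslot f x h :
  (forall (a : 'I_(n * Amax).+1) s I, I \in longest_sets d (qnext x.1.1.1 x.1.2 a s) ->
     f (step k x a s I) <= h a s) ->
  Ek f x <= Eslot h.
Proof.
move=> le_fh; apply: Eslot_le => a s /=; set L := longest_sets _ _.
have L0 : 0 < #|L|%:R :> R by rewrite ltr0n longest_sets_neq0.
apply: (@le_trans _ _ (\sum_(I in L) h a s / #|L|%:R)).
  by apply: ler_sum => I IL; rewrite ler_wpM2r ?invr_ge0 ?(ltW L0) // le_fh.
by rewrite sumr_const -[leLHS]mulr_natr divfK // gt_eqF.
Qed.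

Lemma EkernelZ c f x : Ek (fun y => c * f y) x = c * Ek f x.
Proof.
rewrite -EslotZ; apply: Eslot_ext => a s /=; rewrite mulr_sumr.
by apply: eq_bigr => I _; rewrite mulrA.
Qed.

Lemma EkernelD f g x : Ek (fun y => f y + g y) x = Ek f x + Ek g x.
Proof.
rewrite -EslotD; apply: Eslot_ext => a s /=; rewrite -big_split /=.
by apply: eq_bigr => I _; rewrite mulrDl.
Qed.

Lemma Ekernel_ge_Eslot f x h :
  (forall (a : 'I_(n * Amax).+1) s I, I \in longest_sets d (qnext x.1.1.1 x.1.2 a s) ->
     h a s <= f (step k x a s I)) ->
  Eslot h <= Ek f x.
Proof.
move=> le_hf; rewrite -lerN2 -[- Ek f x]mulN1r -EkernelZ -[- Eslot h]mulN1r.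
rewrite -EslotZ; apply: Ekernel_le_Eslot => a s I /le_hf.
by rewrite !mulN1r lerN2.
Qed.

Lemma Ekernel_le f g x : valid x -> (forall y, valid y -> f y <= g y) ->
  Ek f x <= Ek g x.
Proof.
move=> vx le_fg; apply: Eslot_le => a s /=; apply: ler_sum => I /longest_sets_card cI.
by rewrite ler_wpM2r ?invr_ge0 ?ler0n // le_fg //; apply: valid_step.
Qed.

Lemma Ekernel_cst c x : Ek (fun _ => c) x = c.
Proof.
by apply/eqP; rewrite eq_le -{2 3}(Eslot_cst c) Ekernel_le_Eslot // Ekernel_ge_Eslot.
Qed.

Lemma Ekernel_sum (T : nat) (f : nat -> state n -> R) x :
  \sum_(t < T) Ek (f t) x = Ek (fun y => \sum_(t < T) f t y) x.
Proof.
elim: T => [|T IHT].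
  by rewrite big_ord0 -[LHS](Ekernel_cst 0 x); apply: Eslot_ext => a s;
     apply: eq_bigr => I _; rewrite big_ord0.
rewrite big_ord_recr /= IHT -EkernelD; apply: Eslot_ext => a s.
by apply: eq_bigr => I _; rewrite big_ord_recr.
Qed.

(** Foster's criterion. Each slot spent outside [B] is paid for by a unit decrease of the expected
    value of [V], which cannot fall below 0. *)
Lemma foster (V : state n -> R) (B : seq (state n)) :
  (forall x, 0 <= V x) ->
  (forall x, valid x -> x \notin B -> Ek V x <= V x - 1) ->
  positive_recurrent d k pA pS.
Proof.
(* The drift is not assumed at a starting state inside [B], so the bound is taken after the first
   transition. *)
move=> V0 driftV; exists B => x vx; exists (1 + Ek V x) => T.
pose F t y := if y \in B then 0 else avoid d k pA pS B t y.
elim: T x vx => [|T IHT] x vx.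
  by rewrite big_ord0 addr_ge0 // -(Ekernel_cst 0 x) Ekernel_le.
rewrite big_ord_recl lerD2l -[leLHS]/(\sum_(t < T) Ek (F t) x) Ekernel_sum.
apply: Ekernel_le => // y vy; rewrite /F; have [yB|yB] := boolP (y \in B).
  by rewrite big1.
by apply: le_trans (IHT y vy) _; have := driftV y vy yB; lra.
Qed.

(** Stop the chain on hitting [B]: stopped paths contribute at most 0 to the mean of [h], and a path
    still running after [t] slots at most [H + t C]. The induction on [t] raises [H] by [C] at each
    transition. *)
Lemma submartingale_avoid (h : state n -> R) (B : seq (state n)) (C : R) :
  0 <= C -> {in B, forall y, h y <= 0} ->
  (forall x, valid x -> h x <= Ek h x) ->
  (forall x (a : 'I_(n * Amax).+1) (s : svec n Smax) (I : {set 'I_n}),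
     valid x -> #|I| = d -> h (step k x a s I) <= h x + C) ->
  forall t x (H : R), valid x -> 0 <= H -> h x <= H ->
    h x <= (H + t%:R * C) * avoid d k pA pS B t x.
Proof.
move=> C0 hB subh inc; elim=> [|t IHt] x H vx H0 hxH /=.
  by rewrite mul0r addr0 mulr1.
apply: le_trans (subh x vx) _; rewrite -EkernelZ.
apply: Eslot_le => a s /=; apply: ler_sum => I /longest_sets_card cI.
rewrite ler_wpM2r ?invr_ge0 ?ler0n //; case: ifPn => [/hB|_].
  by rewrite mulr0.
have -> : H + t.+1%:R * C = H + C + t%:R * C by rewrite -natr1; ring.
apply: IHt.
- exact: valid_step.
- exact: addr_ge0.
- by apply: le_trans (inc _ _ _ _ vx cI) _; rewrite lerD2r.
Qed.

End Expectation.

(** Comparison with the harmonic series: each dyadic block from [2 ^ j] to [2 ^ j.+1] adds at least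
    a fixed constant to the sum. *)
Lemma harmonic_unbounded (R : realType) (u : nat -> R) (H C M : R) :
  0 < H -> 0 <= C -> (forall t, H <= (H + t%:R * C) * u t) ->
  exists T, M < \sum_(t < T) u t.
Proof.
(* For [t < 2 ^ j.+1] the factor [H + t C] is at most [2 ^ j * (H + 2 C)], which dictates this
   constant. *)
move=> H0 C0 hu; pose c := H / (H + 2 * C).
have D0 : 0 < H + 2 * C by lra.
have c0 : 0 < c by rewrite divr_gt0.
have u_ge j t : (t < 2 ^ j.+1)%N -> c / (2 ^ j)%:R <= u t.
  move=> lt_t; rewrite /c; set P : R := (2 ^ j)%:R.
  have P1 : 1 <= P by rewrite ler1n expn_gt0.
  have tP : t%:R <= 2 * P by rewrite -natrM ler_nat -expnS ltnW.
  have E0 : 0 < H + t%:R * C by have := mulr_ge0 (ler0n R t) C0; lra.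
  apply: (@le_trans _ _ (H / (H + t%:R * C))); last first.
    by rewrite ler_pdivrMr // mulrC.
  rewrite -mulrA ler_pM2l // -invfM lef_pV2 ?posrE ?mulr_gt0 //; last by lra.
  by have := ler_wpM2r C0 tP; have := ler_pM2l H0 1 P; nra.
have pow2 j : j%:R * c <= \sum_(t < 2 ^ j) u t.
  elim: j => [|j IHj].
    rewrite mul0r expn0 big_ord1; have := hu 0%N; rewrite mul0r addr0; nra.
  rewrite -(big_mkord xpredT) (@big_cat_nat _ _ _ (2 ^ j)%N) ?leq_exp2l //=.
  rewrite -natr1 mulrDl mul1r lerD ?big_mkord //.
  apply: (@le_trans _ _ (\sum_(2 ^ j <= t < 2 ^ j.+1) c / (2 ^ j)%:R)).
    rewrite sumr_const_nat expnS mul2n -addnn addnK -[leRHS]mulr_natr divfK //.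
    by rewrite pnatr_eq0 expn_eq0.
  by rewrite !big_nat; apply: ler_sum => t /andP[_ ?]; apply: u_ge.
exists (2 ^ Num.bound `|M / c|)%N; apply: lt_le_trans (pow2 _).
rewrite -ltr_pdivrMr //.
exact: le_lt_trans (ler_norm _) (archi_boundP (normr_ge0 _)).
Qed.

Lemma sum_notin_card (T : finType) (J I : {set T}) :
  (\sum_(i in J) (i \notin I) = #|J :\: I|)%N.
Proof.
rewrite /nat_of_bool -big_mkcondr sum1_card.
by apply: eq_card => i; rewrite !inE andbC.
Qed.

(** * Forecasts of the queue lengths and their one-slot evolution *)

Section Stability.
Variables (R : realType) (n d k Amax Smax : nat).
Variables (pA : {ffun 'I_(n * Amax).+1 -> R}) (pS : {ffun svec n Smax -> R}).
Hypotheses (lt_dn : (d < n)%N) (k_gt0 : (0 < k)%N).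
Hypotheses (pA_ge0 : forall a, 0 <= pA a) (pA_sum : \sum_a pA a = 1).
Hypotheses (pS_ge0 : forall s, 0 <= pS s) (pS_sum : \sum_s pS s = 1).
Implicit Types (x : state n) (Q : qvec n) (I J : {set 'I_n}) (i : 'I_n).
Implicit Types (a : 'I_(n * Amax).+1) (s : svec n Smax).

Local Notation Ek := (Ekernel d k pA pS).
Local Notation valid := (valid_state d k).
Local Notation Lam := (arrival_mean pA).
Local Notation mu := (mu pS).

Definition remaining x : R := (\sum_i slots k x i)%:R.

(* Queue [i] as predicted for the next observation time, ignoring the positive
   part in the dynamics. *)
Definition forecast x i : R :=
  (x.1.1.1 i)%:R + Lam * (slots k x i)%:R - remaining x * mu i.

(* Forecast minus queue length at the end of the slot, before a new period may
   start. *)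
Definition offset x i : R :=
  Lam * ((slots k x i)%:R - (i == x.1.2)%:R) - (remaining x - 1) * mu i.

(** The centred net input of queue [i] in one slot, that is, the martingale increment of its
    forecast before truncation. *)
Definition noise x a s i : R :=
  (i == x.1.2)%:R * ((a : nat)%:R - Lam) - ((s i : nat)%:R - mu i).

Local Notation queue' x a s := (qnext x.1.1.1 x.1.2 a s).

Lemma Lam_ge0 : 0 <= Lam.
Proof. by apply: sumr_ge0 => a _; rewrite mulr_ge0. Qed.

Lemma mu_ge0 i : 0 <= mu i.
Proof. by apply: sumr_ge0 => s _; rewrite mulr_ge0. Qed.

Lemma remaining_ge1 x : valid x -> 1 <= remaining x.
Proof.
case: x => [[[Q Id] ir] nr] [_ irNId _]; rewrite ler1n.
by rewrite (bigD1 ir) //= (negbTE irNId) leqnn addn1.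
Qed.

Lemma remaining_le x : valid x -> remaining x <= (n * k)%:R.
Proof.
move=> vx; rewrite ler_nat -[n in (n * _)%N]card_ord -sum_nat_const.
by apply: leq_sum => i _; apply: slots_le vx.
Qed.

Lemma forecast_le x i : valid x ->
  forecast x i <= (x.1.1.1 i)%:R + Lam * k%:R.
Proof.
move=> vx; rewrite /forecast -addrA lerD2l.
have : Lam * (slots k x i)%:R <= Lam * k%:R.
  by rewrite ler_wpM2l ?Lam_ge0 // ler_nat; apply: slots_le vx.
have : 0 <= remaining x * mu i by rewrite mulr_ge0 ?mu_ge0 ?ler0n.
lra.
Qed.

Lemma forecast_ge x i : valid x ->
  (x.1.1.1 i)%:R - (n * k)%:R * mu i <= forecast x i.
Proof.
move=> vx; rewrite /forecast.
have : remaining x * mu i <= (n * k)%:R * mu i.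
  by rewrite ler_wpM2r ?mu_ge0 ?remaining_le.
have : 0 <= Lam * (slots k x i)%:R by rewrite mulr_ge0 ?Lam_ge0.
lra.
Qed.

(** Inside a period the forecast changes only through the queue. At its end [offset] vanishes and
    the forecast gains the mean net input of the coming period: [k] rounds of [n - d] slots, feeding
    the queues outside [I] once per round. *)
Lemma forecast_step x a s I : valid x -> #|I| = d ->
  let y := step k x a s I in
  (forall i, forecast y i = (queue' x a s i)%:R + offset x i) /\
  remaining y = remaining x - 1
  \/ [/\ remaining x = 1, remaining y = (k * (n - d))%:R,
         forall i, offset x i = 0 &
         forall i, forecast y i = (queue' x a s i)%:R +
           k%:R * (Lam * (i \notin I)%:R - (n - d)%:R * mu i)].
Proof.
move=> vx cI /=.
have sum_ir : (\sum_i (i == x.1.2) = 1)%N.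
  by rewrite (bigD1 x.1.2) //= eqxx big1 // => i /negbTE->.
have [sl|[sl1 sl2]] := slots_step Smax lt_dn k_gt0 vx.
  have rem_y : remaining (step k x a s I) = remaining x - 1.
    apply/eqP; rewrite eq_sym subr_eq natr1 eqr_nat; apply/eqP.
    by rewrite (eq_bigr _ (fun i _ => sl a s I i)) big_split /= sum_ir addn1.
  left; split=> // i; rewrite /forecast /offset rem_y step_queue (sl a s I i).
  by rewrite natrD; ring.
have rem_x : remaining x = 1.
  by rewrite /remaining (eq_bigr _ (fun i _ => sl1 i)) sum_ir.
have rem_y : remaining (step k x a s I) = (k * (n - d))%:R.
  congr (_ %:R); rewrite (eq_bigr _ (fun i _ => sl2 a s I i cI)).
  rewrite (bigID (mem I)) /= big1 ?add0n; last by move=> i ->.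
  rewrite (eq_bigr (fun=> k)); last by move=> i /negbTE->.
  rewrite sum_nat_const mulnC; congr (_ * _)%N.
  rewrite (@eq_card _ _ (~: I)); last by move=> i; rewrite inE.
  by rewrite cardsCs setCK cI card_ord.
right; split=> // i.
  by rewrite /offset rem_x sl1 !subrr mulr0 mul0r subr0.
rewrite /forecast rem_y step_queue sl2 //; case: (i \in I) => /=.
  by rewrite natrM; ring.
by rewrite natrM; ring.
Qed.

Lemma Eslot_noise x i : Eslot pA pS (fun a s => noise x a s i) = 0.
Proof.
transitivity (Eslot pA pS (fun a s => (i == x.1.2)%:R * (a : nat)%:R +
   ((-1) * (s i : nat)%:R + (mu i - (i == x.1.2)%:R * Lam)))).
  by apply: Eslot_ext => a s; rewrite /noise; ring.
by rewrite !EslotD !EslotZ !Eslot_cst // Eslot_arrival // Eslot_service //; ring.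
Qed.

Lemma queue_noise x a s i :
  (x.1.1.1 i + (if i == x.1.2 then a : nat else 0))%:R - (s i : nat)%:R
    + offset x i = forecast x i + noise x a s i.
Proof.
rewrite /forecast /noise /offset natrD.
by case: (i == x.1.2); rewrite /= ?mulr1n ?mulr0n; ring.
Qed.

(** Truncation at 0 can only raise a queue, which is the direction a submartingale needs. *)
Lemma forecast_noise_le x a s i :
  forecast x i + noise x a s i <= (queue' x a s i)%:R + offset x i.
Proof.
rewrite -queue_noise lerD2r ffunE lerBlDr -natrD ler_nat.
by rewrite [leqRHS]addnC -leq_subLR.
Qed.

Lemma queue'_le x a s i : (queue' x a s i)%:R <= (x.1.1.1 i)%:R + (n * Amax)%:R :> R.
Proof.
rewrite -natrD ler_nat ffunE; apply: leq_trans (leq_subr _ _) _.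
by rewrite leq_add2l; case: ifP => // _; rewrite -ltnS.
Qed.

(** * Necessity: an overloaded set of queues excludes positive recurrence *)

Section Necessity.
Variable I : {set 'I_n}.
Hypothesis lt_dI : (d < #|I|)%N.
Hypothesis overload : (n - d)%:R * \sum_(i in I) mu i <= Lam * (#|I| - d)%:R.

Let g x : R := \sum_(i in I) forecast x i.

Lemma overload_submartingale x : valid x -> g x <= Ek g x.
Proof.
move=> vx; pose h a s : R := \sum_(i in I) (forecast x i + noise x a s i).
have -> : g x = Eslot pA pS h.
  rewrite Eslot_sum; apply: eq_bigr => i _.
  by rewrite EslotD Eslot_cst // Eslot_noise addr0.
apply: Ekernel_ge_Eslot => // a s J /longest_sets_card cJ.
have [[fc _]|[_ _ off0 fc]] := forecast_step a s vx cJ.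
  by apply: ler_sum => i _; rewrite fc forecast_noise_le.
rewrite /g (eq_bigr _ (fun i _ => fc i)) big_split /= -[leLHS]addr0 lerD //.
  by apply: ler_sum => i _; rewrite -[leRHS]addr0 -(off0 i) forecast_noise_le.
(* What remains is the gain of the new period. Since [J] has [d] elements, at least [#|I| - d]
   queues of [I] are fed in each round, and [overload] makes the gain nonnegative. *)
rewrite -mulr_sumr mulr_ge0 // sumrB -!mulr_sumr subr_ge0.
apply: le_trans overload _; rewrite ler_wpM2l ?Lam_ge0 // -natr_sum ler_nat.
rewrite sum_notin_card -cJ leq_subLR -(cardsID J I) leq_add2r.
exact/subset_leq_card/subsetIr.
Qed.

Lemma overload_not_recurrent : ~ positive_recurrent d k pA pS.
Proof.
case=> B recB.
have [m gB] : exists m, {in B, forall y, g y <= m}.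
  elim: B {recB} => [|y B [m IHm]]; first by exists 0.
  exists (Num.max (g y) m) => z; rewrite inE le_max => /predU1P[->|/IHm->].
    by rewrite lexx.
  by rewrite orbT.
(* One slot adds at most [n * Amax] jobs to a queue; the other two terms are the gaps between queue
   length and forecast, above and below. *)
pose C : R := \sum_(i in I) ((n * Amax)%:R + Lam * k%:R + (n * k)%:R * mu i).
have C0 : 0 <= C.
  by apply: sumr_ge0 => i _; rewrite !addr_ge0 ?mulr_ge0 ?Lam_ge0 ?mu_ge0.
have inc x a s J : valid x -> #|J| = d -> g (step k x a s J) - m <= g x - m + C.
  move=> vx cJ; rewrite addrAC lerD2r -big_split /=; apply: ler_sum => i _.
  have vy := valid_step lt_dn a s vx cJ.
  have := forecast_le i vy; have := forecast_ge i vx; rewrite step_queue.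
  by have := queue'_le x a s i; lra.
have [x vx gx] : exists2 x, valid x & m < g x.
  (* With every queue of length [q], the sum over [I] is at least [#|I| * q] minus the service term,
     and [#|I|] is at least 1. *)
  pose q := Num.bound `|m + \sum_(i in I) (n * k)%:R * mu i|.
  have /card_gt0P[J /longest_sets_card cJ] :=
    longest_sets_neq0 lt_dn [ffun _ : 'I_n => 0%N].
  pose i0 := Ordinal (leq_ltn_trans (leq0n d) lt_dn).
  exists ([ffun _ => q], J, rr_first J i0, 0%N).
    by split; rewrite ?(rr_first_notin lt_dn).
  apply: (@lt_le_trans _ _ (\sum_(i in I) (q%:R - (n * k)%:R * mu i))).
    rewrite sumrB sumr_const -[_ *+ _]mulr_natr ltrBrDr.
    apply: le_lt_trans (ler_norm _) _.
    apply: lt_le_trans (archi_boundP (normr_ge0 _)) _.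
    by rewrite ler_peMr // ler1n (leq_trans _ lt_dI).
  apply: ler_sum => i _; set x := (_, _, _, _).
  have vx : valid x by split; rewrite ?(rr_first_notin lt_dn).
  by have := forecast_ge i vx; rewrite /= ffunE.
have [M leM] := recB x vx.
have hx0 : 0 < g x - m by rewrite subr_gt0.
have hB : {in B, forall y, g y - m <= 0} by move=> y /gB; rewrite subr_le0.
have sub_h y : valid y -> g y - m <= Ek (fun z => g z - m) y.
  move=> vy; rewrite EkernelD Ekernel_cst // lerD2r.
  exact: overload_submartingale.
have low t : g x - m <= (g x - m + t%:R * C) * avoid d k pA pS B t x.
  by apply: submartingale_avoid C0 hB sub_h inc _ _ _ vx (ltW hx0) _.
by have [T] := harmonic_unbounded M hx0 C0 low; rewrite ltNge leM.
Qed.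

End Necessity.

(** * Sufficiency: drift of the quadratic Lyapunov function *)

Section Sufficiency.
Hypothesis mu_gt0 : forall i, 0 < mu i.
Hypothesis subcritical : forall I, (d < #|I|)%N ->
  Lam < (n - d)%:R / (#|I| - d)%:R * \sum_(i in I) mu i.

(** There are finitely many sets [J], so their strict inequalities share a common margin. For
    nonempty [J] with at most [d] elements the truncated [#|J| - d] is 0, and strictness comes from
    positive service rates. *)
Lemma capacity_gap : exists2 eps : R, 0 < eps &
  forall J, Lam * (#|J| - d)%:R + eps * #|J|%:R <= (n - d)%:R * \sum_(i in J) mu i.
Proof.
have nd0 : 0 < (n - d)%:R :> R by rewrite ltr0n subn_gt0.
have n0 : 0 < n%:R :> R by rewrite ltr0n; apply: leq_ltn_trans lt_dn.
pose gap J : R := ((n - d)%:R * (\sum_(i in J) mu i) - Lam * (#|J| - d)%:R) / n%:R.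
have gap0 J : J != set0 -> 0 < gap J.
  case/set0Pn => j jJ; rewrite divr_gt0 // subr_gt0.
  have [le_Jd|lt_dJ] := leqP #|J| d.
    rewrite (eqP le_Jd) mulr0 mulr_gt0 // (bigD1 j) //= ltr_pwDl //.
    by apply: sumr_ge0 => i _; apply: mu_ge0.
  have J0 : 0 < (#|J| - d)%:R :> R by rewrite ltr0n subn_gt0.
  by have := subcritical lt_dJ; rewrite mulrAC ltr_pdivlMr.
(* The default 1 only keeps the minimum positive. Dividing each gap by [n] allows the margin to be
   multiplied by [#|J|], which is at most [n]. *)
exists (\big[Num.min/1]_(J | J != set0) gap J); first exact: lt_bigmin.
move=> J; have [->|J0] := eqVneq J set0.
  by rewrite cards0 sub0n !mulr0 addr0 big_set0 mulr0.
rewrite addrC -lerBrDr.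
apply: (@le_trans _ _ (gap J * n%:R)); last by rewrite divfK ?gt_eqF.
apply: ler_pM => //.
- by apply: ltW; apply: lt_bigmin.
- exact: bigmin_le_cond.
- by rewrite ler_nat -[X in (_ <= X)%N]card_ord max_card.
Qed.

(* Layer-cake: the claim is linear in [Q], and holds for the indicator of each
   level set of [Q] because such a set either contains [I] or is contained
   in it. *)
Lemma observation_drift (eps : R) Q I :
  (forall J, Lam * (#|J| - d)%:R + eps * #|J|%:R <= (n - d)%:R * \sum_(i in J) mu i) ->
  I \in longest_sets d Q ->
  \sum_i (Q i)%:R * (Lam * (i \notin I)%:R - (n - d)%:R * mu i)
    <= - eps * \sum_i (Q i)%:R.
Proof.
move=> gap QI; pose z i := Lam * (i \notin I)%:R - (n - d)%:R * mu i + eps.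
suff : \sum_i (Q i)%:R * z i <= 0.
  rewrite (eq_bigr (fun i => (Q i)%:R * (Lam * (i \notin I)%:R - (n - d)%:R * mu i)
     + eps * (Q i)%:R)); last by move=> i _; rewrite /z; ring.
  by rewrite big_split /= -mulr_sumr; lra.
(* The total length serves as a common bound on the queues, hence as the number of layers. *)
pose M := (\sum_i Q i)%N.
have layers i : (Q i)%:R = \sum_(m < M) (m < Q i)%:R :> R.
  have le_QM : (Q i <= M)%N by rewrite /M (bigD1 i) //= leq_addr.
  rewrite -natr_sum; congr (_ %:R); rewrite /nat_of_bool -big_mkcond /=.
  by rewrite -(big_ord_widen_cond _ xpredT (fun=> 1%N)) // sum1_card card_ord.
rewrite (eq_bigr _ (fun i _ => congr1 (fun q => q * z i) (layers i))).
under eq_bigr do rewrite mulr_suml.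
rewrite exchange_big; apply: sumr_le0 => m _ /=.
pose J := [set i | (m < Q i)%N].
rewrite (eq_bigr (fun i => if i \in J then z i else 0)); last first.
  by move=> i _; rewrite inE; case: ltnP => _; rewrite ?mul1r ?mul0r.
rewrite -big_mkcond /z /= big_split sumrB -!mulr_sumr /= sumr_const -mulr_natr.
have := gap J; suff : \sum_(i in J) (i \notin I)%:R <= (#|J| - d)%:R :> R.
  by move=> /(ler_wpM2l Lam_ge0); lra.
rewrite -natr_sum ler_nat sum_notin_card.
have [->|/set0Pn[j]] := eqVneq (J :\: I) set0; first by rewrite cards0.
rewrite !inE => /andP[jI lt_mj].
have IJ : I \subset J.
  apply/subsetP => i iI; rewrite inE; apply: leq_trans lt_mj _.
  exact: longest_sets_ge QI iI jI.
by rewrite cardsD (setIidPr IJ) (longest_sets_card QI).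
Qed.

Let Boff i : R := Lam * k.+1%:R + (n * k).+1%:R * mu i.
Let Bnoise i : R := (n * Amax)%:R + Lam + Smax%:R + mu i.

Lemma sqr_le_abs (y c : R) : - c <= y -> y <= c -> y ^+ 2 <= c ^+ 2.
Proof. by move=> ge_y le_y; nra. Qed.

Lemma offset_sqr_le x i : valid x -> offset x i ^+ 2 <= Boff i ^+ 2.
Proof.
move=> vx; rewrite /offset /Boff.
have L0 := Lam_ge0; have m0 := mu_ge0 i.
have r1 := remaining_ge1 vx; have rn := remaining_le vx.
have c0 : 0 <= (slots k x i)%:R :> R by [].
have ck : (slots k x i)%:R <= k%:R :> R by rewrite ler_nat; apply: slots_le vx.
have e0 : 0 <= (i == x.1.2)%:R :> R by [].
have e1 : (i == x.1.2)%:R <= 1 :> R by case: eqP.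
move: (slots k x i)%:R (i == x.1.2)%:R (remaining x) c0 ck e0 e1 r1 rn => c e r.
move=> c0 ck e0 e1 r1 rn; rewrite -!natr1.
have k0 := ler0n R k; have nk0 := ler0n R (n * k).
have u_le : c - e <= k%:R + 1 by lra.
have u_ge : - (k%:R + 1) <= c - e by lra.
have v_le : r - 1 <= (n * k)%:R + 1 by lra.
have v_ge : - ((n * k)%:R + 1) <= r - 1 by lra.
have := ler_wpM2l L0 u_le; have := ler_wpM2l L0 u_ge.
have := ler_wpM2r m0 v_le; have := ler_wpM2r m0 v_ge.
by move=> *; apply: sqr_le_abs; lra.
Qed.

Lemma noise_sqr_le x a s i : noise x a s i ^+ 2 <= Bnoise i ^+ 2.
Proof.
have L0 := Lam_ge0; have m0 := mu_ge0 i.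
have a0 : 0 <= (a : nat)%:R :> R by [].
have aA : (a : nat)%:R <= (n * Amax)%:R :> R by rewrite ler_nat -ltnS.
have s0 : 0 <= (s i : nat)%:R :> R by [].
have sS : (s i : nat)%:R <= Smax%:R :> R by rewrite ler_nat -ltnS.
by rewrite /noise /Bnoise; case: eqP => _ /=; apply: sqr_le_abs; lra.
Qed.

(* Truncation at [0] only replaces a negative queue length by [0], at the cost
   of [offset ^ 2]. *)
Lemma queue'_offset_sqr_le x a s i :
  ((queue' x a s i)%:R + offset x i) ^+ 2 <=
  (forecast x i + noise x a s i) ^+ 2 + offset x i ^+ 2.
Proof.
rewrite -queue_noise ffunE.
have [le_sq|/ltnW le_qs] := leqP (s i) (x.1.1.1 i + (if i == x.1.2 then a : nat else 0)).
  by rewrite natrB // lerDl sqr_ge0.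
by rewrite (eqP le_qs) add0r lerDr sqr_ge0.
Qed.

Definition lyapunov (delta : R) x : R :=
  \sum_i forecast x i ^+ 2 + delta * remaining x * \sum_i (x.1.1.1 i)%:R.

Lemma lyapunov_drift : exists2 delta : R, 0 < delta & exists C, forall x, valid x ->
  Ek (lyapunov delta) x <=
    lyapunov delta x - delta * \sum_i (x.1.1.1 i)%:R + C.
Proof.
have [eps eps0 gap] := capacity_gap.
have nd0 : 0 < (n - d)%:R :> R by rewrite ltr0n subn_gt0.
(* With this value the jump [delta * k * (n - d)] of the second term's coefficient at an observation
   equals [2 * k * eps], exactly what the cross term of the squares pays for. *)
pose delta := 2 * eps / (n - d)%:R; have delta0 : 0 < delta.
  by rewrite divr_gt0 // mulr_gt0.
pose Bobs i := k%:R * (Lam + (n - d)%:R * mu i).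
pose C1 : R := \sum_i (Boff i ^+ 2 + Bobs i ^+ 2) +
  delta * (n * k)%:R * \sum_(i < n) (n * Amax)%:R.
exists delta => //; exists (C1 + \sum_i Bnoise i ^+ 2) => x vx.
pose q x := \sum_i (x.1.1.1 i)%:R : R.
(* A majorant of the next Lyapunov value that does not depend on the tie-break. *)
pose h a s := \sum_i (forecast x i + noise x a s i) ^+ 2 +
  (delta * (remaining x - 1) * q x + C1).
have rem0 : 0 <= delta * (remaining x - 1).
  by rewrite mulr_ge0 ?(ltW delta0) ?subr_ge0 ?remaining_ge1.
apply: (@le_trans _ _ (Eslot pA pS h)).
  apply: Ekernel_le_Eslot => // a s I LI; have cI := longest_sets_card LI.
  set y := step _ _ _ _ _; pose q' : R := \sum_i (queue' x a s i)%:R.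
  have qy : \sum_i (y.1.1.1 i)%:R = q' by rewrite /y step_queue.
  have q'_le : q' <= q x + \sum_(i < n) (n * Amax)%:R.
    by rewrite -big_split; apply: ler_sum => i _; apply: queue'_le.
  have Vy : lyapunov delta y <=
      \sum_i (((queue' x a s i)%:R + offset x i) ^+ 2 + Bobs i ^+ 2)
      + delta * (remaining x - 1) * q'.
    rewrite /lyapunov qy; have [[fc rem_y]|[rem_x rem_y off0 fc]] := forecast_step a s vx cI.
      rewrite rem_y lerD2r; apply: ler_sum => i _.
      by rewrite fc lerDl sqr_ge0.
    rewrite rem_x rem_y subrr mulr0 mul0r addr0.
    pose w i : R := Lam * (i \notin I)%:R - (n - d)%:R * mu i.
    (* Expanding the square isolates the cross term of queue length and [w], to which
       [observation_drift] applies; the square of [k * w] is bounded. *)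
    have le_w : \sum_i forecast y i ^+ 2 <= \sum_i
        (((queue' x a s i)%:R + offset x i) ^+ 2 + Bobs i ^+ 2
         + 2 * k%:R * ((queue' x a s i)%:R * w i)).
      apply: ler_sum => i _; rewrite fc off0 addr0 -/(w i).
      have : (k%:R * w i) ^+ 2 <= Bobs i ^+ 2.
        have L0 := Lam_ge0; have m0 := mulr_ge0 (ltW nd0) (mu_ge0 i).
        rewrite !exprMn ler_wpM2l ?exprn_ge0 // /w.
        by case: (i \notin I); apply: sqr_le_abs; rewrite /=; lra.
      by nra.
    apply: le_trans (lerD le_w (lexx _)) _.
    rewrite big_split /= -addrA gerDl -mulr_sumr.
    have := observation_drift gap LI; rewrite -/q'.
    have -> : delta * (k * (n - d))%:R = 2 * k%:R * eps.
      by rewrite natrM /delta; field; rewrite gt_eqF.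
    by move=> /(ler_wpM2l (ler0n R k)); lra.
  apply: le_trans Vy _; rewrite big_split /h /C1 big_split /=.
  have : \sum_i ((queue' x a s i)%:R + offset x i) ^+ 2 <=
      \sum_i (forecast x i + noise x a s i) ^+ 2 + \sum_i Boff i ^+ 2.
    rewrite -big_split /=; apply: ler_sum => i _.
    apply: le_trans (queue'_offset_sqr_le _ _ _ _) _.
    by rewrite lerD2l offset_sqr_le.
  have : delta * (remaining x - 1) * q' <= delta * (remaining x - 1) * q x +
      delta * (n * k)%:R * \sum_(i < n) (n * Amax)%:R.
    apply: le_trans (ler_wpM2l rem0 q'_le) _; rewrite mulrDr lerD2l.
    rewrite ler_wpM2r ?sumr_ge0 // ler_pM2l //.
    by have := remaining_le vx; lra.
  by lra.
rewrite EslotD Eslot_cst // Eslot_sum.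
(* The noise has mean zero, so the cross term drops out and only its bounded square remains. *)
suff : \sum_i Eslot pA pS (fun a s => (forecast x i + noise x a s i) ^+ 2) <=
    \sum_i forecast x i ^+ 2 + \sum_i Bnoise i ^+ 2.
  by rewrite /lyapunov -/(q x); lra.
rewrite -big_split /=; apply: ler_sum => i _.
apply: (@le_trans _ _ (Eslot pA pS (fun a s =>
   forecast x i ^+ 2 + Bnoise i ^+ 2 + (2 * forecast x i) * noise x a s i))).
  by apply: Eslot_le => // a s; have := noise_sqr_le x a s i; lra.
by rewrite EslotD Eslot_cst // EslotZ Eslot_noise mulr0 addr0.
Qed.

(** With queues at most [K] and fewer than [k] completed rounds, every state is the image of a point
    of a finite type. *)
Lemma finite_level (K : nat) : exists B : seq (state n), forall x,
  valid x -> (forall i, x.1.1.1 i <= K)%N -> x \in B.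
Proof.
pose F (u : {ffun 'I_n -> 'I_K.+1} * {set 'I_n} * 'I_n * 'I_k) : state n :=
  ([ffun i => (u.1.1.1 i : nat)], u.1.1.2, u.1.2, (u.2 : nat)).
exists (codom F) => -[[[Q Id] ir] nr] [_ _ lt_nr] leQ.
apply/codomP; exists ([ffun i => inord (Q i)], Id, ir, Ordinal lt_nr).
rewrite /F /=; congr (_, _, _, _); apply/ffunP => i.
by rewrite !ffunE inordK // ltnS.
Qed.

Lemma subcritical_recurrent : positive_recurrent d k pA pS.
Proof.
have [delta delta0 [C drift]] := lyapunov_drift.
(* Outside [B] some queue exceeds [(C + 1) / delta], and the drift is then at most -1. *)
have [B finB] := finite_level (Num.bound `|(C + 1) / delta|).
apply: (@foster _ _ _ _ _ _ pA pS _ _ _ _ _ (lyapunov delta) B) => // [x|x vx xB].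
  rewrite addr_ge0 ?sumr_ge0 // => [i _|]; first exact: sqr_ge0.
  by rewrite !mulr_ge0 ?(ltW delta0) ?sumr_ge0 ?ler0n.
apply: le_trans (drift x vx) _.
have [i lt_i] : exists i, (Num.bound `|(C + 1) / delta| < x.1.1.1 i)%N.
  apply/existsP; apply: contraNT xB; rewrite negb_exists => /forallP le_x.
  by apply: finB => // i; rewrite leqNgt.
suff : C + 1 <= delta * \sum_i (x.1.1.1 i)%:R by lra.
rewrite mulrC -ler_pdivrMr //; apply: le_trans (ler_norm _) _.
apply: le_trans (ltW (archi_boundP (normr_ge0 _))) _.
by rewrite -natr_sum ler_nat (bigD1 i) //= ltnW // (leq_trans lt_i) ?leq_addr.
Qed.

End Sufficiency.
End Stability.

Theorem theorem1 (R : realType) (n d k Amax Smax : nat)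
  (pA : {ffun 'I_(n * Amax).+1 -> R}) (pS : {ffun svec n Smax -> R}) :
  (1 <= k)%N -> (1 <= d)%N -> (d < n)%N ->
  (forall a, 0 <= pA a) -> \sum_a pA a = 1 ->
  (forall s, 0 <= pS s) -> \sum_s pS s = 1 ->
  (forall i : 'I_n, 0 < mu pS i) ->
  positive_recurrent d k pA pS <->
  (forall I : {set 'I_n}, (d.+1 <= #|I|)%N ->
     arrival_mean pA <
       (n - d)%:R / (#|I| - d)%:R * \sum_(l in I) mu pS l).
Proof.
move=> k0 _ lt_dn pA0 pA1 pS0 pS1 mu0; split; last exact: subcritical_recurrent.
move=> rec I lt_dI; rewrite ltNge; apply/negP => overload.
apply: (overload_not_recurrent lt_dn k0 pA0 pA1 pS0 pS1 lt_dI) rec.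
by move: overload; rewrite mulrAC ler_pdivrMr // ltr0n subn_gt0.
Qed.
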